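(* Let $k \ge 1$ be an integer. For any $3^k$ consecutive integers, the sequences $w_k(n) \in \{-1,0,1\}^k$ associated with these integers $n$ are pairwise different. Moreover these sequences are repeated periodically with period $3^k$: $w_k(n + 3^k q) = w_k(n)$ for all integers $n$ and $q$.
   Context: The original Collatz function $g : \mathbb{Z} \to \mathbb{Z}$ is defined by $g(n) = \frac{2n}{3}$ if $n \equiv 0 \pmod 3$, $g(n) = \frac{4n-1}{3}$ if $n \equiv 1 \pmod 3$, and $g(n) = \frac{4n+1}{3}$ if $n \equiv 2 \pmod 3$. Write $g^{(j)}$ for the $j$-th iterate of $g$, with $g^{(0)}(n) = n$. For an integer $n$ and $j \ge 0$, let $t_j(n)$ be the unique element of $\{-1,0,1\}$ such that $g^{(j)}(n) \equiv -t_j(n) \pmod 3$. For $k \ge 1$ put $w_k(n) = (t_0(n), t_1(n), \ldots, t_{k-1}(n))$. *)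

(* Defs.v *)
From mathcomp Require Import all_boot all_order all_algebra.
From mathcomp Require Import zify.

Set Implicit Arguments.
Unset Strict Implicit.
Unset Printing Implicit Defensive.

Import Order.TTheory GRing.Theory Num.Theory.
Local Open Scope ring_scope.

(* The original Collatz function; the quotients are exact, see
   [collatz_exact]. *)
Definition collatz (n : int) : int :=
  if (n %% 3)%Z == 0 then ((2 * n) %/ 3)%Z
  else if (n %% 3)%Z == 1 then ((4 * n - 1) %/ 3)%Z
  else ((4 * n + 1) %/ 3)%Z.

Definition trits : seq int := [:: -1; 0; 1].

(* The unique t in {-1, 0, 1} with m = - t modulo 3; the default value 0 of
   [head] is never used, see [tritP] and [trit_uniq]. *)
Definition trit (m : int) : int :=
  head 0 [seq t <- trits | (m == - t %[mod 3])%Z].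

Definition collatz_trit (j : nat) (n : int) : int := trit (iter j collatz n).

Definition collatz_word (k : nat) (n : int) : k.-tuple int :=
  [tuple collatz_trit j n | j < k].

Lemma collatz_exact (n : int) :
  3 * collatz n =
    if (n %% 3)%Z == 0 then 2 * n
    else if (n %% 3)%Z == 1 then 4 * n - 1 else 4 * n + 1.
Proof. by rewrite /collatz; case: ifP => [/eqP|/eqP] h; [lia|case: ifP => /eqP h'; lia]. Qed.

Lemma tritP (m : int) : trit m \in trits /\ (m = - trit m %[mod 3])%Z.
Proof.
rewrite /trit /=.
case: ifP => [/eqP // | /eqP h1]; case: ifP => [/eqP // | /eqP h2].
by case: ifP => [/eqP // | /eqP h3]; exfalso; lia.
Qed.

Lemma trit_uniq (m t : int) :
  t \in trits -> (m = - t %[mod 3])%Z -> t = trit m.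
Proof.
have [+ +] := tritP m; move: (trit m) => u.
by rewrite !inE => /or3P[] /eqP-> h /or3P[] /eqP-> h'; lia.
Qed.

(* Main.v *)
Require Import Defs.
From mathcomp Require Import all_boot all_order all_algebra.
From mathcomp Require Import zify.

Set Implicit Arguments.
Unset Strict Implicit.
Unset Printing Implicit Defensive.

Import Order.TTheory GRing.Theory Num.Theory.
Local Open Scope ring_scope.

(** The first [k] letters of the words of [m] and [n] agree exactly when [3^k]
    divides [m - n]. Indeed, if [m] and [n] agree modulo 3, then
    [3 (g m - g n) = c (m - n)] with [c] equal to 2 or 4, which is coprime to
    3; so [3^k] divides [g m - g n] exactly when [3^(k+1)] divides [m - n]. *)

Lemma trit_eq_mod3 (m n : int) : (trit m == trit n) = (3 %| m - n)%Z.
Proof.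
have [_ hm] := tritP m; have [tn hn] := tritP n.
apply/eqP/idP => [e | d]; first by move: hm; rewrite e => hm; lia.
by apply/esym/trit_uniq => //; lia.
Qed.

Lemma collatz_sub (m n : int) : (3 %| m - n)%Z ->
  exists2 c : int, coprimez 3 c & 3 * (collatz m - collatz n) = c * (m - n).
Proof.
move=> d; have := collatz_exact m; have := collatz_exact n.
have -> : (m %% 3)%Z = (n %% 3)%Z by lia.
(* Both integers now take the same branch of [collatz], so the constant terms cancel in the
   difference and the slope 2 or 4 is left. *)
case: ifP => _; first by exists 2 => //; lia.
by case: ifP => _; exists 4 => //; lia.
Qed.

Lemma dvdz_collatz_sub (k : nat) (m n : int) : (3 %| m - n)%Z ->
  (3 ^+ k %| collatz m - collatz n)%Z = (3 ^+ k.+1 %| m - n)%Z.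
Proof.
move=> /collatz_sub[c c3 e].
rewrite -(@dvdz_mul2l 3) // -exprS e Gauss_dvdzr //.
exact: coprimezXl.
Qed.

(** Induction on [k] with [m] and [n] general: the first letter decides divisibility by 3, and the
    later letters are those of [collatz m] and [collatz n]. *)
Lemma collatz_trits_eq (k : nat) (m n : int) :
  (forall j, (j < k)%N -> collatz_trit j m = collatz_trit j n) <->
  (3 ^+ k %| m - n)%Z.
Proof.
elim: k m n => [|k IHk] m n; first by rewrite expr0 dvd1z.
have trS j p : collatz_trit j.+1 p = collatz_trit j (collatz p).
  by rewrite /collatz_trit iterSr.
split=> [h | d].
  have d3 : (3 %| m - n)%Z by rewrite -trit_eq_mod3; apply/eqP/(h 0%N).
  rewrite -dvdz_collatz_sub //; apply/IHk => j ltjk.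
  by rewrite -!trS; apply: h.
have d3 : (3 %| m - n)%Z by apply: dvdz_trans d; rewrite exprS dvdz_mulr.
(* Letter 0 is [trit] itself, by conversion. *)
case=> [_ | j ltjk]; first by apply/eqP; rewrite [_ == _]trit_eq_mod3.
by rewrite !trS; move: j ltjk; apply/IHk; rewrite dvdz_collatz_sub.
Qed.

Lemma collatz_word_eq (k : nat) (m n : int) :
  collatz_word k m = collatz_word k n <-> (3 ^+ k %| m - n)%Z.
Proof.
rewrite -collatz_trits_eq; split=> [e j ltjk | h].
  by have := congr1 (fun t => tnth t (Ordinal ltjk)) e; rewrite !tnth_mktuple.
by apply: eq_from_tnth => j; rewrite !tnth_mktuple h.
Qed.

Theorem theorem2p3 (k : nat) (hk : (1 <= k)%N) :
  (forall a m n : int,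
     a <= m < a + 3 ^+ k -> a <= n < a + 3 ^+ k -> m != n ->
     collatz_word k m <> collatz_word k n) /\
  (forall n q : int, collatz_word k (n + 3 ^+ k * q) = collatz_word k n).
Proof.
split=> [a m n hm hn neq_mn /collatz_word_eq /dvdzP[q e] | n q].
  (* Both integers lie in a window of length [N], so [m - n = q * N] has absolute value below [N],
     which forces [q = 0]. *)
  move: (3 ^+ k : int) hm hn e => N hm hn e.
  have [q_gt0 | q_lt0 | q0] := ltrgtP 0 q; [nia | nia |].
  by move: e neq_mn; rewrite -q0 mul0r => /subr0_eq ->; rewrite eqxx.
by apply/collatz_word_eq; rewrite addrC addKr dvdz_mulr.
Qed.
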